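(* Let $(X, d)$ be a complete metric space, let $x_0 \in X$ be an arbitrarily chosen point, and write $\|x\| := d(x, x_0)$ for $x \in X$. Let $\Lambda \ge 0$, $\alpha \ge 1$ and $\beta \ge 0$ be fixed real constants, and let $\psi : [0,1] \to [0,\infty)$ be an increasing function that vanishes with continuity at zero (i.e. $\psi(0) = 0$ and $\psi(\varepsilon) \to 0$ as $\varepsilon \to 0^+$). Let $T : X \to X$ be a map such that the inequality $$d(Tx, Ty) \le \frac{1-\varepsilon}{2}\left\{ d(x, Tx) + d(y, Ty) \right\} + \Lambda \varepsilon^{\alpha} \psi(\varepsilon) \left[ 1 + \|x\| + \|Tx\| + \|y\| + \|Ty\| \right]^{\beta}$$ is satisfied for all $\varepsilon \in [0,1]$ and all $x, y \in X$. Then $T$ possesses a unique fixed point, i.e. there is a unique $x^* \in X$ with $x^* = Tx^*$.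
   Context: The notation $\|x\|$ is shorthand for the distance $d(x, x_0)$ to the chosen base point $x_0$ (the ''zero'' of $X$); no linear structure on $X$ is assumed. The map $T$ is not assumed continuous. *)

(* Defs.v *)
From HB Require Import structures.
From mathcomp Require Import all_boot all_order all_algebra.
From mathcomp Require Import all_classical all_reals all_analysis.

Set Implicit Arguments.
Unset Strict Implicit.
Unset Printing Implicit Defensive.

Import Order.TTheory GRing.Theory Num.Theory.
Import numFieldNormedType.Exports.

Local Open Scope classical_set_scope.
Local Open Scope ring_scope.

(* [Complete] bundles a default point; it is harmless, the theory being about
   spaces with a chosen point [x0], and it need not coincide with [x0]. *)
#[short(type="completeMetricType")]
HB.structure Definition CompleteMetric (K : numDomainType) :=
  { M of Metric K M & Complete M }.

(* Not a norm: [X] has no linear structure and [x0] is an arbitrary point. *)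
Definition dist_from (R : realType) (X : metricType R) (x0 x : X) : R :=
  mdist x x0.

(* [psi] is a total function of which only the values on `[0, 1] matter, and
   "increasing" is meant in the wide sense. *)
Definition vanishing_modulus (R : realType) (psi : R -> R) : Prop :=
  [/\ {in `[0, 1], forall e, 0 <= psi e},
      {in `[0, 1] &, {homo psi : e1 e2 / e1 <= e2}},
      psi 0 = 0
    & psi e @[e --> 0^'+] --> 0].

(* At [e = 0] the perturbation vanishes, both because [psi 0 = 0] and because
   [0 `^ alpha = 0] for [alpha != 0]. *)
Definition kannan_pata (R : realType) (X : metricType R) (x0 : X)
    (Lambda alpha beta : R) (psi : R -> R) (T : X -> X) : Prop :=
  forall e : R, e \in `[0, 1] -> forall x y : X,
    mdist (T x) (T y) <=
      (1 - e) / 2 * (mdist x (T x) + mdist y (T y)) +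
      Lambda * e `^ alpha * psi e *
        (1 + dist_from x0 x + dist_from x0 (T x)
           + dist_from x0 y + dist_from x0 (T y)) `^ beta.

(* Main.v *)
(* At [e = 0] the hypothesis says that [T] is a Kannan map with constant 1/2:
   d(Tx, Ty) <= (d(x, Tx) + d(y, Ty)) / 2. Hence the steps d(T^n x0, T^(n+1) x0)
   are nonincreasing and every orbit is bounded, so that along the orbit of [x0]
   the power [beta] only contributes a constant factor, whatever its size. The
   limit [l] of the steps then satisfies l <= (1 - e) l + K e psi(e), that is
   l <= K psi(e), for every [e] in (0, 1], and so vanishes. A Kannan map with
   arbitrarily small steps along an orbit has a fixed point, the orbit being
   Cauchy. *)
Require Import Defs.
From HB Require Import structures.
From mathcomp Require Import all_boot all_order all_algebra.
From mathcomp Require Import all_classical all_reals all_analysis.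
From mathcomp Require Import ring lra.

Set Implicit Arguments.
Unset Strict Implicit.
Unset Printing Implicit Defensive.

Import Order.TTheory GRing.Theory Num.Theory.
Import numFieldNormedType.Exports.

Local Open Scope classical_set_scope.
Local Open Scope ring_scope.

Definition kannan (R : realType) (X : metricType R) (T : X -> X) : Prop :=
  forall x y : X, mdist (T x) (T y) <= (mdist x (T x) + mdist y (T y)) / 2.

Definition step (R : realType) (X : metricType R) (T : X -> X) (x : X)
    (n : nat) : R :=
  mdist (iter n T x) (iter n.+1 T x).

Lemma step_ge0 (R : realType) (X : metricType R) (T : X -> X) (x : X) n :
  0 <= step T x n.
Proof. exact: mdist_ge0. Qed.

Lemma kannan_step_nonincreasing (R : realType) (X : metricType R) (T : X -> X)
  (x : X) : kannan T -> nonincreasing_seq (step T x).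
Proof.
move=> kT; apply/nonincreasing_seqP => n.
have := kT (iter n T x) (iter n.+1 T x); rewrite /step /=; lra.
Qed.

(** The Kannan inequality at [iter n T x] and [x] bounds the distance from [iter n.+1 T x] to [T x]
    by the mean of two steps, each at most [step T x 0]; the triangle inequality through [T x] adds
    one more such step. *)
Lemma kannan_orbit_bounded (R : realType) (X : metricType R) (T : X -> X)
    (x : X) n :
  kannan T -> mdist (iter n T x) x <= 2 * step T x 0.
Proof.
move=> kT; have s0 := step_ge0 T x 0.
case: n => [|n]; first by rewrite mdistxx mulr_ge0.
have sn : step T x n <= step T x 0.
  exact: (kannan_step_nonincreasing x kT (leq0n n)).
have := kT (iter n T x) x.
have := metric_triangle (iter n.+1 T x) (T x) x.
rewrite (metric_sym (T x) x) /step /= in s0 sn *; lra.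
Qed.

Lemma kannan_fixed_point_unique (R : realType) (X : metricType R) (T : X -> X)
    (x y : X) :
  kannan T -> x = T x -> y = T y -> x = y.
Proof.
move=> kT xT yT; apply: mdist_positivity; apply/eqP; rewrite eq_le mdist_ge0.
by have := kT x y; rewrite -xT -yT !mdistxx addr0 mul0r => ->.
Qed.

Lemma kannan_fixed_point_exists (R : realType) (X : completeMetricType R)
    (T : X -> X) (x : X) :
  kannan T -> step T x n @[n --> \oo] --> 0 -> exists z : X, z = T z.
Proof.
move=> kT s0.
have s_lt e : 0 < e -> \forall n \near \oo, step T x n < e.
  by move=> e0; exact: (cvgr_lt 0 s0).
have /cauchy_cvg xl : cauchy (iter n T x @[n --> \oo]).
  (* The centre has index [N.+1] because the Kannan inequality controls images: two iterates of
     positive index are as close as the mean of the steps preceding them. *)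
  apply: cauchy_exP => e /s_lt[N _ sN]; exists (iter N.+1 T x).
  exists N.+1 => // -[//|n] /= Nn; rewrite ballEmdist /=.
  have := kT (iter N T x) (iter n T x).
  have := sN _ (leqnn N); have := sN _ Nn; rewrite /step /=; lra.
set z := lim (iter n T x @[n --> \oo]) in xl.
exists z; apply: mdist_positivity; apply/eqP; rewrite eq_le mdist_ge0 andbT.
(* No continuity of [T] is available. The Kannan inequality at [iter n T x] and [z] leaves half of
   d(z, Tz) on the right; absorbing it gives d(z, Tz) <= 2 d(z, T^(n+1) x) + d(T^n x, T^(n+1) x),
   hence less than 3e/4 with both distances below e/4. *)
apply/ler_addgt0Pl => e e0; rewrite addr0.
have e4 : 0 < e / 4 by rewrite divr_gt0.
have [N _ zN] := metricType_numDomainType.cvgr_dist_lt xl e4.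
have [M _ sM] := s_lt _ e4.
pose n := maxn N M.
have zn : mdist z (iter n.+1 T x) < e / 4.
  by apply: zN; rewrite /= (leq_trans (leq_maxl N M)).
have sn : step T x n < e / 4 by apply: sM; exact: leq_maxr.
have := kT (iter n T x) z.
have := metric_triangle z (iter n.+1 T x) (T z).
rewrite /step /= in zn sn *; lra.
Qed.

(** The order of limits matters: [n] goes to infinity with [e] fixed, the result is divided by [e],
    and only then does [e] tend to 0. *)
Lemma perturbed_contraction_cvg0 (R : realType) (u : R ^nat) (K : R)
    (psi : R -> R) :
  (forall n, 0 <= u n) -> nonincreasing_seq u ->
  psi e @[e --> 0^'+] --> 0 ->
  (forall e n, 0 < e <= 1 ->
    u n.+1 <= (1 - e) / 2 * (u n + u n.+1) + K * (e * psi e)) ->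
  u n @[n --> \oo] --> 0.
Proof.
move=> u0 u_dec psi0 hu.
have cu : cvgn u.
  by apply: nonincreasing_is_cvgn => //; exists 0 => _ [n _ <-]; exact: u0.
suff <- : limn u = 0 by [].
have cSu : u n.+1 @[n --> \oo] --> limn u by rewrite cvg_shiftS.
apply/eqP; rewrite eq_le; apply/andP; split; last by apply: limr_ge => //; near=> n.
have Kpsi : K * psi e @[e --> 0^'+] --> K * 0 by exact: cvgMl_tmp.
rewrite -(mulr0 K); apply: (ler_cvg_to (cvg_cst (limn u)) Kpsi).
near=> e.
have e0 : 0 < e by near: e; exact: nbhs_right_gt.
have e1 : e <= 1 by near: e; exact: nbhs_right_le.
have le_lim : limn u <= (1 - e) / 2 * (limn u + limn u) + K * (e * psi e).
  have rhs_cvg : (1 - e) / 2 * (u n + u n.+1) + K * (e * psi e) @[n --> \oo] -->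
      (1 - e) / 2 * (limn u + limn u) + K * (e * psi e).
    apply: cvgD; last exact: cvg_cst.
    by apply: cvgMl_tmp; apply: cvgD; [exact: cu | exact: cSu].
  apply: (ler_cvg_to cSu rhs_cvg).
  by apply: nearW => n; apply: hu; rewrite e0.
rewrite -(ler_pM2l e0) /=; lra.
Unshelve. all: by end_near. Qed.

Lemma kannan_pata_kannan (R : realType) (X : metricType R) (x0 : X)
    (Lambda alpha beta : R) (psi : R -> R) (T : X -> X) :
  psi 0 = 0 -> kannan_pata x0 Lambda alpha beta psi T -> kannan T.
Proof.
move=> psi0 hT x y; have := hT 0 _ x y.
by rewrite psi0 mulr0 mul0r addr0 subr0 mul1r mulrC in_itv/= lexx ler01; apply.
Qed.

(** The points involved are the iterates of index [n], [n.+1] (twice) and [n.+2], each within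
    [2 * step T x0 0] of [x0]; hence the 8. *)
Lemma kannan_pata_step (R : realType) (X : metricType R) (x0 : X)
    (Lambda alpha beta : R) (psi : R -> R) (T : X -> X) (e : R) n :
  0 <= Lambda -> 1 <= alpha -> 0 <= beta -> 0 < e <= 1 -> 0 <= psi e ->
  kannan T -> kannan_pata x0 Lambda alpha beta psi T ->
  step T x0 n.+1 <= (1 - e) / 2 * (step T x0 n + step T x0 n.+1) +
    Lambda * (1 + 8 * step T x0 0) `^ beta * (e * psi e).
Proof.
move=> hL ha hb /andP[e0 e1] p0 kT hT.
have eI : e \in `[0, 1] by rewrite in_itv/= (ltW e0).
apply: le_trans (hT e eI (iter n T x0) (iter n.+1 T x0)) _.
rewrite lerD2l.
rewrite [leRHS](_ : _ = Lambda * e * psi e * (1 + 8 * step T x0 0) `^ beta);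
  last by ring.
have b k : mdist (iter k T x0) x0 <= 2 * step T x0 0.
  exact: kannan_orbit_bounded.
have ge0 k := mdist_ge0 (iter k T x0) x0.
apply: ler_pM; rewrite ?mulr_ge0 ?powR_ge0//.
  by rewrite ler_wpM2r// ler_wpM2l// ge1r_powR// e0.
have := (b n, b n.+1, b n.+2, ge0 n, ge0 n.+1, ge0 n.+2).
move=> [[[[[b0 b1] b2] g0] g1] g2]; have s0 := step_ge0 T x0 0.
rewrite /dist_from /= in b0 b1 b2 g0 g1 g2 *.
by apply: ge0_ler_powR; rewrite ?nnegrE//; lra.
Qed.

Theorem theorem2p2 (R : realType) (X : completeMetricType R) (x0 : X)
    (Lambda alpha beta : R) (psi : R -> R) (T : X -> X)
    (hLambda : 0 <= Lambda) (halpha : 1 <= alpha) (hbeta : 0 <= beta)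
    (hpsi : vanishing_modulus psi)
    (hT : kannan_pata x0 Lambda alpha beta psi T) :
  exists! x : X, x = T x.
Proof.
case: hpsi => psi_ge0 _ psi0 psi_cvg.
have kT := kannan_pata_kannan psi0 hT.
(* The orbit starts at the base point, so that the norms in the perturbation are distances to the
   start of the orbit. *)
have [|z zT] := kannan_fixed_point_exists (x := x0) kT.
  apply: (perturbed_contraction_cvg0 (step_ge0 T x0)
    (kannan_step_nonincreasing x0 kT) psi_cvg) => e n e01.
  have psie : 0 <= psi e.
    by apply: psi_ge0; case/andP: e01 => e0 e1; rewrite in_itv/= (ltW e0).
  exact: kannan_pata_step psie kT hT.
by exists z; split=> // y yT; exact: kannan_fixed_point_unique zT yT.
Qed.
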